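(* Let $q\ge 2$ be an integer, let $h_q$ be the morphism on $\{a,b\}^*$ given by $h_q(a)=a^qb$, $h_q(b)=b$, and let $\mathbf z_q=\lim_{n\to\infty}h_q^n(a)$ be its infinite fixed point starting with $a$. Then for every $n\ge 0$ the number of distinct factors of $\mathbf z_q$ of length $n$ equals $$\sum_{0\le i\le n}\min(q^i,\,n-i+1).$$
   Context: A factor of an infinite word is a finite contiguous block of it. *)

(* Defs.v *)
From HB Require Import structures.
From mathcomp Require Import all_boot.
From mathcomp Require Import boolp.

Set Implicit Arguments.
Unset Strict Implicit.
Unset Printing Implicit Defensive.

Inductive letter : Type := La | Lb.

Definition bool_of_letter (x : letter) : bool := if x is La then true else false.
Definition letter_of_bool (x : bool) : letter := if x then La else Lb.

Lemma bool_of_letterK : cancel bool_of_letter letter_of_bool.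
Proof. by case. Qed.

HB.instance Definition _ := Finite.copy letter (can_type bool_of_letterK).

Definition word := seq letter.

Definition infinite_word := nat -> letter.

Definition morphism_of (f : letter -> word) (w : word) : word :=
  flatten [seq f x | x <- w].

Definition h (q : nat) : word -> word :=
  morphism_of (fun x => if x is La then rcons (nseq q La) Lb else [:: Lb]).

(* Convergence of finite words to an infinite word in the product topology:
   every prefix of z is a prefix of u n for all large n; in particular the
   lengths of the u n tend to infinity. *)
Definition word_limit (u : nat -> word) (z : infinite_word) : Prop :=
  forall k, exists N, forall n, N <= n -> prefix (mkseq z k) (u n).

Definition factor (z : infinite_word) (w : word) : Prop :=
  exists i, w = mkseq (fun j => z (i + j)) (size w).

Definition subword_complexity (z : infinite_word) (n : nat) : nat :=
  #|[set w : n.-tuple letter | `[< factor z w >]]|.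

Lemma word_limit_unique (u : nat -> word) (z1 z2 : infinite_word) :
  word_limit u z1 -> word_limit u z2 -> z1 =1 z2.
Proof.
move=> H1 H2 i; have [N1 P1] := H1 i.+1; have [N2 P2] := H2 i.+1.
have /prefixP[s1 E1] := P1 _ (leq_maxl N1 N2).
have /prefixP[s2 E2] := P2 _ (leq_maxr N1 N2).
have := congr1 (fun s => nth La s i) (etrans (esym E1) E2).
by rewrite !nth_cat !size_mkseq ltnSn !nth_mkseq.
Qed.

Lemma h_cat q u v : h q (u ++ v) = h q u ++ h q v.
Proof. by rewrite /h /morphism_of map_cat flatten_cat. Qed.

Lemma h_iter_prefix q n m : 0 < q -> n <= m ->
  prefix (iter n (h q) [:: La]) (iter m (h q) [:: La]).
Proof.
move=> q0; have step k :
    prefix (iter k (h q) [:: La]) (iter k.+1 (h q) [:: La]).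
  elim: k => [|k /prefixP[s Es]].
    by case: q q0 => // q _; rewrite /= /h /morphism_of /= prefix0s.
  by apply/prefixP; exists (h q s); exact: etrans (congr1 (h q) Es) (h_cat _ _ _).
move=> /subnKC <-; elim: (m - n) => [|k IH]; first by rewrite addn0 prefix_refl.
by rewrite addnS; exact: prefix_trans IH (step _).
Qed.

Lemma h_iter_size q n : 0 < q -> n < size (iter n (h q) [:: La]).
Proof.
move=> q0.
have szh w : size w + count_mem La w <= size (h q w).
  elim: w => // x w IH; rewrite -cat1s h_cat !size_cat count_cat addnACA.
  apply: leq_add IH; case: x; rewrite /h /morphism_of /= ?cats0 //.
  by rewrite size_rcons size_nseq !addn0 add1n ltnS.
elim: n => // n IH; rewrite iterS; apply: leq_trans (szh _).
rewrite -addn1 leq_add // -has_count has_pred1.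
have /prefixP[s ->] := h_iter_prefix q0 (leq0n n).
by rewrite /= inE eqxx.
Qed.

(* The fixed point exists, so hypotheses of this form are not vacuous. *)
Lemma word_limit_h_exists q : 0 < q ->
  exists z, word_limit (fun n => iter n (h q) [:: La]) z.
Proof.
move=> q0; exists (fun i => nth La (iter i (h q) [:: La]) i) => k.
exists k => n kn; apply: prefix_trans (h_iter_prefix q0 kn).
rewrite prefixE size_mkseq; apply/eqP/(@eq_from_nth _ La).
  by rewrite size_takel ?size_mkseq // ltnW // h_iter_size.
move=> i; rewrite size_takel ?(ltnW (h_iter_size _ q0)) // => ik.
rewrite nth_take // nth_mkseq //.
have /prefixP[s ->] := h_iter_prefix q0 (ltnW ik).
by rewrite nth_cat h_iter_size.
Qed.

(* Main.v *)
(** For a binary word in which every factor extends to the right, p(n+1) - p(n)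
    is the number of right special factors of length n, that is, of factors w
    with both wa and wb factors.  These are the suffixes of the words
    R_0 = a^(q-1), R_(j+1) = b h(R_j): if w ends in b, then reading wa and wb
    through h yields a right special v such that w is a suffix of b h(v); if w
    ends in a, then w is a block of fewer than q letters a.  Since R_j ends in
    a b^j and has length q^(j+1) + j - 1, there is exactly one right special
    factor of length n for each j <= n with n - j < q^(j+1); summing these
    differences gives the formula. *)

Require Import Defs.
From mathcomp Require Import all_boot.
From mathcomp Require Import boolp.

Set Implicit Arguments.
Unset Strict Implicit.
Unset Printing Implicit Defensive.

(** * Prefixes and suffixes of finite words *)

Lemma suffix_cat_or (T : eqType) (w s t : seq T) : suffix w (s ++ t) ->
  suffix w t \/ exists2 w', w = w' ++ t & suffix w' s.
Proof.
elim/last_ind: t w => [|t x IH] w.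
  by rewrite cats0; right; exists w; rewrite ?cats0.
case/lastP: w => [|w y]; first by left; rewrite suffix0s.
rewrite -rcons_cat suffix_rcons => /andP[/eqP-> /IH[wt|[w' -> w's]]].
  by left; rewrite suffix_rcons eqxx.
by right; exists w'; rewrite ?rcons_cat.
Qed.

Lemma suffix_comparable (T : eqType) (w t s : seq T) :
  suffix w s -> suffix t s -> size w <= size t -> suffix w t.
Proof.
move=> ws /suffixP[s' Es]; move: ws; rewrite Es => /suffix_cat_or[//|[w' -> _]].
rewrite size_cat -{2}[size t]add0n leq_add2r leqn0 size_eq0 => /eqP->.
exact: suffix_refl.
Qed.

Lemma prefix_cat_or (T : eqType) (w s t : seq T) : prefix w (s ++ t) ->
  prefix w s \/ exists2 w', w = s ++ w' & prefix w' t.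
Proof.
elim: s w => [|x s IH] [|y w] //=; first by right; exists [::]; rewrite ?prefix0s.
- by right; exists (y :: w).
- by left.
by move=> /andP[/eqP-> /IH[ws|[w' -> w't]]]; [left; rewrite eqxx | right; exists w'].
Qed.

Lemma suffix_eq (T : eqType) (w t : seq T) : suffix w t -> size w = size t -> w = t.
Proof. by rewrite suffixE => /eqP + Ewt; rewrite Ewt subnn drop0 => ->. Qed.

Lemma rcons_nseq (T : Type) n (x : T) : rcons (nseq n x) x = nseq n.+1 x.
Proof. by rewrite -cats1 -(nseqD n 1) addn1. Qed.

Lemma mkseq_add (T : Type) (f : nat -> T) m n :
  mkseq f (m + n) = mkseq f m ++ mkseq (fun j => f (m + j)) n.
Proof. by rewrite /mkseq iotaD map_cat add0n -{2}[m]addn0 iotaDl -map_comp. Qed.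

(** * Desubstitution under the morphism *)

Section Morphism.
Variable q : nat.

Lemma h_a : h q [:: La] = rcons (nseq q La) Lb.
Proof. by rewrite /h /morphism_of /= cats0. Qed.

Lemma h_b : h q [:: Lb] = [:: Lb].
Proof. by []. Qed.

Lemma h_rcons w x : h q (rcons w x) = h q w ++ h q [:: x].
Proof. by rewrite -cats1 h_cat. Qed.

Lemma h_rcons_a w : h q (rcons w La) = rcons (h q w ++ nseq q La) Lb.
Proof. by rewrite h_rcons h_a rcons_cat. Qed.

Lemma h_rcons_b w : h q (rcons w Lb) = rcons (h q w) Lb.
Proof. by rewrite h_rcons h_b cats1. Qed.

Lemma h_nilVrcons w : h q w = [::] \/ exists u, h q w = rcons u Lb.
Proof.
case/lastP: w => [|w []]; [by left | right | right].
- by exists (h q w ++ nseq q La); rewrite h_rcons_a.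
- by exists (h q w); rewrite h_rcons_b.
Qed.

Lemma h_neq_rcons_a w u : h q w <> rcons u La.
Proof. by case: (h_nilVrcons w) => [->|[v ->]]; [case: u|move=> /rcons_inj[]]. Qed.

Lemma h_cat_nseq_a w u i : h q w ++ nseq i.+1 La = rcons u La -> u = h q w ++ nseq i La.
Proof. by rewrite -rcons_nseq -rcons_cat => /rcons_inj[]. Qed.

Lemma h_cat_nseq_b w u i : h q w ++ nseq i La = rcons u Lb -> i = 0.
Proof. by case: i => // i; rewrite -rcons_nseq -rcons_cat => /rcons_inj[]. Qed.

(** A prefix of h(Y) cuts at most one block a^q b, after [i] of its letters a. If [i] is positive,
    the coerced boolean appends to [Y'] the letter a of [Y] whose image is cut. *)
Lemma prefix_h p Y : prefix p (h q Y) ->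
  exists Y' i, [/\ p = h q Y' ++ nseq i La, i <= q & prefix (Y' ++ nseq (0 < i) La) Y].
Proof.
elim: Y p => [|x Y IH] p.
  by rewrite prefixs0 => /eqP->; exists [::], 0.
rewrite -cat1s h_cat => /prefix_cat_or[|[p' -> /IH[Y' [i [-> iq YY]]]]]; last first.
  exists (x :: Y'), i; rewrite -[in h q (x :: Y')]cat1s h_cat catA; split=> //.
  by rewrite cat_cons prefix_cons eqxx.
case: x; last first.
  rewrite h_b prefixs1 => /orP[] /eqP->; first by exists [::], 0; rewrite prefix0s.
  by exists [:: Lb], 0; rewrite prefix_cons eqxx prefix0s.
rewrite h_a -cats1 => /prefix_cat_or[p_a|[p' -> ]].
  have /all_pred1P Ep : all (pred1 La) p.
    move: p_a => /prefixP[r] /(congr1 (all (pred1 La))).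
    by rewrite all_cat all_pred1_nseq => /esym/andP[].
  exists [::], (size p); split; first by rewrite -Ep.
    by rewrite -(size_nseq q La) size_prefix.
  by case: (size p) => [|k]; exact: prefix0s.
rewrite prefixs1 => /orP[] /eqP->; last first.
  exists [:: La], 0; rewrite h_a !cats0 -cats1; split=> //.
  by rewrite prefix_cons eqxx prefix0s.
exists [::], q; rewrite cats0; split=> //.
by case: (0 < q); exact: prefix0s.
Qed.

(** A final b closes the image of a letter, so [p] is cut between two images. The next image starts
    with the letter it comes from, because q > 0; hence [x] is also the next letter of [Y]. *)
Lemma desubst_rcons Y p u x : 0 < q -> p = rcons u Lb -> prefix (rcons p x) (h q Y) ->
  exists2 Y', p = h q Y' & prefix (rcons Y' x) Y.
Proof.
move=> q_gt0 Ep /prefix_h[Y' [i [+ iq YY]]]; case: x.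
  case: i iq YY => [_ _|i iq YY /esym/h_cat_nseq_a E].
    by rewrite cats0 => /esym/h_neq_rcons_a.
  move: E; rewrite Ep => /esym E; have i0 := h_cat_nseq_b E.
  by move: E YY; rewrite i0 cats0 cats1 => E YY; exists Y'; rewrite // Ep E.
move=> /esym E; have i0 := h_cat_nseq_b E; move: E YY; rewrite i0 !cats0.
case/lastP: Y' => [|Y' []]; first by case: (p).
  rewrite h_rcons_a => /rcons_inj[E]; move: q_gt0.
  by rewrite Ep in E; rewrite (h_cat_nseq_b E).
by rewrite h_rcons_b => /rcons_inj[<-] YY; exists Y'.
Qed.

Lemma homo_suffix_h u v : suffix u v -> suffix (h q u) (h q v).
Proof. by move=> /suffixP[s ->]; rewrite h_cat suffix_suffix. Qed.

Lemma homo_prefix_h u v : prefix u v -> prefix (h q u) (h q v).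
Proof. by move=> /prefixP[s ->]; rewrite h_cat prefix_prefix. Qed.

(* Images under h are empty or end in b, so where Y1 and Y2 first differ, read
   from the right, their images still share one b, and nothing more. *)
Lemma common_suffix_h Y1 Y2 w : 0 < q -> suffix w (h q Y1) -> suffix w (h q Y2) ->
  exists v, [/\ suffix v Y1, suffix v Y2 & suffix w (Lb :: h q v)].
Proof.
move=> q_gt0.
have diff Y Y' u : suffix u (h q (rcons Y La)) -> suffix u (h q (rcons Y' Lb)) ->
    suffix u [:: Lb].
  rewrite h_rcons_a h_rcons_b.
  case/lastP: u => [|u x]; first by rewrite suffix0s.
  rewrite !suffix_rcons => /andP[/eqP-> uY] /andP[_ uY'].
  case/lastP: u uY uY' => [//|u y].
  case: (h_nilVrcons Y') => [->|[v ->]]; first by rewrite suffixs0; case: u.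
  case: q q_gt0 => // k _; rewrite -rcons_nseq -rcons_cat !suffix_rcons.
  by case: y.
elim/last_ind: Y1 Y2 w => [|Y1 x IH] Y2 w w1 w2.
  by exists [::]; rewrite !suffix0s; split=> //; exact: (@suffix_catr _ _ _ [:: Lb]) w1.
case/lastP: Y2 w2 => [|Y2 y] w2.
  by exists [::]; rewrite !suffix0s; split=> //; exact: (@suffix_catr _ _ _ [:: Lb]) w2.
case: (eqVneq x y) => [xy|xy].
  rewrite -xy in w2 *; move: w1 w2; rewrite !h_rcons => /suffix_cat_or[wx _|].
    exists [:: x]; split; rewrite -?cats1 ?suffix_suffix //.
    exact: (@suffix_catr _ _ _ [:: Lb]) wx.
  move=> [w' -> w1]; rewrite suffix_catl // eqxx => /(IH _ _ w1)[v [v1 v2 wv]].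
  exists (rcons v x); rewrite !suffix_rcons eqxx; split=> //.
  by rewrite h_rcons -cat_cons suffix_catl // eqxx.
exists [::]; rewrite !suffix0s; split=> //.
by case: x y xy w1 w2 => [] [] // _ w1 w2; [apply: diff w1 w2 | apply: diff w2 w1].
Qed.


(** Maximal runs of a in h(Y) have length exactly q. This excludes longer runs;
    [suffix_nseq_before_b] excludes shorter ones. *)
Lemma not_suffix_nseq_before_a Y p :
  prefix (rcons p La) (h q Y) -> ~~ suffix (nseq q La) p.
Proof.
move=> /prefix_h[Y' [[|i] [+ iq _]]]; first by rewrite cats0 => /esym /h_neq_rcons_a.
move=> /esym/h_cat_nseq_a->; apply/negP.
(* Since i < q, a suffix a^q would reach past a^i and force h(Y') to end in a. *)
have -> : nseq q La = nseq (q - i.+1).+1 La ++ nseq i La.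
  by rewrite -nseqD addSnnS subnK.
rewrite suffix_catl // eqxx -rcons_nseq => /suffixP[s].
by rewrite -rcons_cat => /h_neq_rcons_a.
Qed.

Lemma suffix_nseq_before_b Y p u : p = rcons u La ->
  prefix (rcons p Lb) (h q Y) -> suffix (nseq q La) p.
Proof.
move=> Ep /prefix_h[Y' [i [+ _ _]]] => /esym E.
have i0 := h_cat_nseq_b E; move: E; rewrite i0 cats0.
case/lastP: Y' => [|Y' []]; first by case: (p).
  by rewrite h_rcons_a => /rcons_inj[<-]; rewrite suffix_suffix.
by rewrite h_rcons_b Ep => /rcons_inj[E]; case: (h_neq_rcons_a E).
Qed.

(** * The words R_j and the right special factors *)

Lemma count_a_h w : count_mem La (h q w) = q * count_mem La w.
Proof.
elim/last_ind: w => [|w x IH]; first by rewrite muln0.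
rewrite h_rcons -cats1 !count_cat IH mulnDr; congr (_ + _).
case: x; rewrite ?h_a ?h_b -?cats1 ?count_cat ?count_nseq //=;
  by rewrite ?mul1n ?muln0 ?muln1 ?addn0.
Qed.

Lemma size_h w : size (h q w) = size w + q * count_mem La w.
Proof.
elim/last_ind: w => [|w x IH]; first by rewrite muln0.
rewrite h_rcons -cats1 !count_cat !size_cat IH mulnDr [RHS]addnACA; congr (_ + _).
case: x; first by rewrite addn0 size_rcons size_nseq /= addn0 muln1 add1n.
by rewrite muln0.
Qed.

(** The words R_j. The [Lb] in front is the one extra letter that [common_suffix_h] allows two
    images to share. *)
Fixpoint max_special j : word :=
  if j is j'.+1 then Lb :: h q (max_special j') else nseq q.-1 La.

Lemma count_a_max_special j : count_mem La (max_special j) = q.-1 * q ^ j.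
Proof.
elim: j => [|j IH] /=; first by rewrite count_nseq mul1n expn0 muln1.
by rewrite count_a_h IH expnS mulnCA.
Qed.

Hypothesis q_gt1 : 1 < q.
Let q_gt0 : 0 < q := ltnW q_gt1.

Lemma size_max_special j : (size (max_special j)).+1 = q ^ j.+1 + j.
Proof.
elim: j => [|j IH] /=; first by rewrite size_nseq prednK // expn1 addn0.
rewrite size_h -addSn IH count_a_max_special mulnCA -expnS.
by rewrite addnAC -mulSn prednK // -expnS addnS.
Qed.

(** As h(a) ends in ab and h fixes b, each application of h lengthens the final run of b by one. The
    length of that run tells the R_j apart. *)
Lemma suffix_max_special j : suffix (La :: nseq j Lb) (max_special j).
Proof.
elim: j => [|j /homo_suffix_h IH] /=.
  by case: q q_gt1 => [|[|k]] // _; rewrite -rcons_nseq -cats1 suffix_suffix.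
apply: (@suffix_catr _ _ _ [:: Lb]); apply: suffix_trans IH.
have hb k : h q (nseq k Lb) = nseq k Lb.
  by elim: k => // k IH; rewrite -[nseq _ _]cat1s h_cat IH.
rewrite -[La :: nseq j Lb]cat1s h_cat hb h_a.
case: q q_gt0 => // k _; rewrite -rcons_nseq.
by rewrite -!cats1 -!catA suffix_suffix.
Qed.

(** The nonempty context [La :: s] on the left carries the induction: its image ends in b, which is
    the b in front of h(R_j) in R_(j+1). *)
Lemma max_special_extend j x : exists k s,
  prefix (La :: s ++ rcons (max_special j) x) (iter k (h q) [:: La]).
Proof.
elim: j => [|j [k [s /homo_prefix_h Hp]]] /=.
  case: x; last first.
    exists 1, [::]; rewrite /= h_a -rcons_cons -[La :: nseq _ _]/(nseq q.-1.+1 La).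
    by rewrite prednK // prefix_refl.
  (* As q >= 2, h^2(a) begins with h(a)h(a). The first block is [La :: s], and the a^q of the second
     is R_0 followed by a. *)
  exists 2, (rcons (nseq q.-1 La) Lb).
  rewrite -cat_cons -rcons_cons -[La :: nseq _ _]/(nseq q.-1.+1 La).
  rewrite rcons_nseq prednK //= h_a.
  have aab : rcons (nseq q La) Lb = [:: La] ++ [:: La] ++ rcons (nseq q.-2 La) Lb.
    by case: q q_gt1 => [|[|k]].
  rewrite [X in prefix _ (h q X)]aab 2!h_cat h_a prefix_catr // eqxx.
  by rewrite -cats1 -catA prefix_prefix.
have [t Et] : exists t, h q (La :: s) = La :: t.
  by rewrite -cat1s h_cat h_a; case: q q_gt0 => // p _; eexists.
have [u Eu] : exists u, h q (La :: s) = La :: rcons u Lb.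
  case: (h_nilVrcons (La :: s)) => [|[[|y u] E]]; first by rewrite Et.
    by rewrite Et in E.
  by move: E; rewrite Et => -[_ ->]; exists u.
exists k.+1, u; apply: prefix_trans Hp; rewrite -[La :: s ++ _]cat_cons h_cat Eu h_rcons.
rewrite -cat_rcons -[rcons (h q _) x]cats1 -cat_cons !prefix_catr // !eqxx /=.
(* The image of [x] begins with [x]. *)
by case: x; rewrite ?h_a ?h_b ?prefix_refl //; case: q q_gt0 => // p _; exact: prefix0s.
Qed.

(** The two occurrences lie in separate iterates, so that each can be desubstituted on its own; [n]
    and [m] then drop together. *)
Lemma special_suffix n m Y1 Y2 w :
  prefix (rcons Y1 La) (iter n (h q) [:: La]) ->
  prefix (rcons Y2 Lb) (iter m (h q) [:: La]) ->
  suffix w Y1 -> suffix w Y2 -> exists j, suffix w (max_special j).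
Proof.
elim: n m Y1 Y2 w => [|n IH] m Y1 Y2 w.
  case: Y1 => [|x [|y Y1]]; rewrite ?prefix_cons ?prefixs0 ?andbF //.
  by rewrite suffixs0 => _ _ /eqP-> _; exists 0; rewrite suffix0s.
case: m => [|m].
  by case: Y2 => [|x [|y Y2]]; rewrite ?prefix_cons ?prefixs0 ?andbF.
rewrite !iterS => P1 P2; case/lastP: w => [|w []] w1 w2.
- by exists 0; rewrite suffix0s.
- have /suffixP[s2 E2] := w2; rewrite -rcons_cat in E2.
  have a2 := suffix_nseq_before_b E2 P2.
  exists 0; have := not_suffix_nseq_before_a P1.
  (* Here [Y2] ends in a^q and [Y1] does not, so their common suffix is shorter than q and hence a
     block of letters a inside R_0. *)
  case: (leqP q (size (rcons w La))) => [qw|wq].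
    have /suffix_trans : suffix (nseq q La) (rcons w La).
      by apply: suffix_comparable a2 w2 _; rewrite size_nseq.
    by move=> /(_ _ w1) ->.
  move=> _; have /suffixP[s] : suffix (rcons w La) (nseq q La).
    by apply: suffix_comparable w2 a2 _; rewrite size_nseq ltnW.
  move=> E; have : all (pred1 La) (s ++ rcons w La) by rewrite -E all_pred1_nseq.
  rewrite all_cat => /andP[_ /all_pred1P ->].
  have {}wq : size (rcons w La) <= q.-1 by rewrite -ltnS prednK.
  by rewrite [max_special 0]/= -(subnK wq) nseqD suffix_suffix.
- have /suffixP[s1 E1] := w1; rewrite -rcons_cat in E1.
  have /suffixP[s2 E2] := w2; rewrite -rcons_cat in E2.
  have [Y1' EY1 P1'] := desubst_rcons q_gt0 E1 P1.
  have [Y2' EY2 P2'] := desubst_rcons q_gt0 E2 P2.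
  rewrite EY1 in w1; rewrite EY2 in w2.
  have [v [v1 v2 wv]] := common_suffix_h q_gt0 w1 w2.
  have [j vj] := IH _ _ _ _ P1' P2' v1 v2.
  (* With R_j = s v, the word h(s) is empty or ends in b. In both cases a b stands before h(v) in b
     h(R_j). *)
  exists j.+1; apply: suffix_trans wv _; have /suffixP[s /= ->] := vj.
  rewrite h_cat; case: (h_nilVrcons s) => [->|[u ->]]; first exact: suffix_refl.
  by rewrite -cats1 -catA -cat_cons suffix_suffix.
Qed.

End Morphism.

(** * Counting the factors of the fixed point *)

Section Complexity.
Variables (q : nat) (z : infinite_word).
Hypothesis q_gt1 : 1 < q.
Hypothesis hz : word_limit (fun k => iter k (h q) [:: La]) z.

(** The iterates are prefixes of one another, so an occurrence in one of them persists in all later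
    ones and hence in [z]. *)
Lemma factorP w : factor z w <->
  exists k s, prefix (s ++ w) (iter k (h q) [:: La]).
Proof.
split=> [[i Ew]|[k [s sw]]].
  have [N /(_ N (leqnn N))] := hz (i + size w).
  by rewrite mkseq_add -Ew; exists N, (mkseq z i).
have [N /(_ _ (leq_maxl N k))] := hz (size (s ++ w)).
have := prefix_trans sw (h_iter_prefix (ltnW q_gt1) (leq_maxr N k)).
rewrite !prefixE size_mkseq => /eqP-> /eqP.
rewrite size_cat mkseq_add => /eqP; rewrite eqseq_cat ?size_mkseq //.
by move=> /andP[_ /eqP Ew]; exists (size s).
Qed.

Lemma factor_rconsW w x : factor z (rcons w x) -> factor z w.
Proof.
move=> [i]; rewrite size_rcons => E; exists i; move: E.
by rewrite -addn1 mkseq_add cats1 => /rcons_inj[].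
Qed.

Lemma factor_extend w : factor z w -> factor z (rcons w La) \/ factor z (rcons w Lb).
Proof.
move=> [i Ew].
have : factor z (rcons w (z (i + size w))).
  by exists i; rewrite size_rcons -addn1 mkseq_add -Ew -cats1 /mkseq /= addn0.
by case: (z _); [left | right].
Qed.

Lemma special_factorP n (w : n.-tuple letter) :
  factor z (rcons w La) /\ factor z (rcons w Lb) <->
  exists j : 'I_n.+1, suffix w (max_special q j).
Proof.
split=> [[/factorP[k1 [s1 P1]] /factorP[k2 [s2 P2]]]|[j wj]].
  rewrite -rcons_cat in P1; rewrite -rcons_cat in P2.
  have [j wj] := special_suffix q_gt1 P1 P2 (suffix_suffix _ _) (suffix_suffix _ _).
  case: (leqP j n) => [jn|nj].
    by exists (Ordinal (jn : j < n.+1)).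
  (* If j > n, then [w] is b^n, which is a suffix of R_n as well, so the index n serves. *)
  exists ord_max => /=.
  have bj : suffix (nseq n Lb) (max_special q j).
    apply: suffix_trans (suffix_max_special q_gt1 j).
    apply: (@suffix_catr _ _ _ [:: La]).
    by rewrite -(subnK (ltnW nj)) nseqD suffix_suffix.
  have -> : (w : word) = nseq n Lb.
    apply: suffix_eq; last by rewrite size_tuple size_nseq.
    by apply: suffix_comparable wj bj _; rewrite size_tuple size_nseq.
  apply: suffix_trans (suffix_max_special q_gt1 n).
  exact: (suffix_suffix [:: La]).
have ext x : factor z (rcons w x).
  have [k [s P]] := max_special_extend q_gt1 j x; move: wj P => /suffixP[t ->].
  by rewrite rcons_cat catA -cat_cons => P; apply/factorP; exists k, (La :: s ++ t).
by split.
Qed.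

(** If i < j, then [w] is long enough to end both in a b^i and in b^(i+1), which is absurd. Without
    the length bounds, a short power of b would be a suffix of several R_j. *)
Lemma suffix_max_special_inj w i j : suffix w (max_special q i) ->
  suffix w (max_special q j) -> i <= size w -> j <= size w -> i = j.
Proof.
suff lt a b : suffix w (max_special q a) -> suffix w (max_special q b) ->
    b <= size w -> ~~ (a < b).
  move=> wi wj iw jw; apply/eqP; rewrite eqn_leq.
  by rewrite leqNgt (lt _ _ wj wi iw) leqNgt (lt _ _ wi wj jw).
move=> wa wb bw; apply/negP => ab.
have aw : suffix (La :: nseq a Lb) w.
  apply: suffix_comparable (suffix_max_special q_gt1 a) wa _.
  by rewrite /= size_nseq (leq_trans ab).
have : suffix (nseq a.+1 Lb) w.
  apply: suffix_comparable _ wb _; last by rewrite size_nseq (leq_trans ab).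
  apply: suffix_trans (suffix_max_special q_gt1 b).
  by apply: (@suffix_catr _ _ _ [:: La]); rewrite -(subnK ab) nseqD suffix_suffix.
move=> /(suffix_comparable aw); rewrite /= size_nseq => /(_ (leqnn _)).
by move=> /suffix_eq; rewrite /= => /(_ erefl).
Qed.

Definition special n : {set n.-tuple letter} :=
  [set w : n.-tuple letter |
    `[< factor z (rcons w La) >] && `[< factor z (rcons w Lb) >]].

Lemma card_special n :
  #|special n| = \sum_(j < n.+1) (n - j < q ^ j.+1).
Proof.
(* The suffix of R_j of length n. The default a^n is never reached for [j] in [D]. *)
pose g (j : 'I_n.+1) : n.-tuple letter :=
  insubd (nseq_tuple n La) (drop (size (max_special q j) - n) (max_special q j)).
pose D := [set j : 'I_n.+1 | n <= size (max_special q j)].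
have gE j : j \in D -> suffix (g j) (max_special q j).
  rewrite inE => jD; rewrite /g val_insubd size_drop subKn // eqxx.
  exact: suffix_drop.
have -> : special n = g @: D.
  apply/setP => w; rewrite inE; apply/idP/imsetP.
    move=> /andP[/asboolP wa /asboolP wb].
    have [j wj] := (special_factorP w).1 (conj wa wb).
    have jD : j \in D by rewrite inE; move: (size_suffix wj); rewrite size_tuple.
    exists j => //; apply: val_inj; apply: suffix_eq; last by rewrite !size_tuple.
    by apply: suffix_comparable wj (gE _ jD) _; rewrite !size_tuple.
  move=> [j jD ->]; have [//|wa wb] := (special_factorP (g j)).2.
    by exists j; exact: gE.
  by apply/andP; split; apply/asboolP.
rewrite card_in_imset => [|i j iD jD gij]; last first.
  apply: val_inj; apply: (@suffix_max_special_inj (g i)); first exact: gE.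
  - by rewrite gij; exact: gE.
  - by rewrite size_tuple -ltnS ltn_ord.
  - by rewrite size_tuple -ltnS ltn_ord.
rewrite -sum1_card big_mkcond; apply: eq_bigr => j _.
have j_le_n : j <= n by rewrite -ltnS ltn_ord.
(* n <= |R_j| means n < q^(j+1) + j. *)
by rewrite inE -ltnS size_max_special // addnC -ltn_subLR //.
Qed.

(** Sorting the factors of length n+1 by last letter gives |B_a| + |B_b|, which equals the size of
    the union plus that of the intersection. The union is all factors of length n, since each
    extends to the right. *)
Lemma subword_complexityS n :
  subword_complexity z n.+1 = subword_complexity z n + #|special n|.
Proof.
pose f x (w : n.-tuple letter) : n.+1.-tuple letter := rcons_tuple w x.
pose B x := [set w : n.-tuple letter | `[< factor z (rcons w x) >]].
have f_inj x : injective (f x).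
  by move=> u v /(congr1 val) /rcons_inj[/val_inj].
rewrite /subword_complexity.
have -> : [set w : n.+1.-tuple letter | `[< factor z w >]] =
    f La @: B La :|: f Lb @: B Lb.
  apply/setP => w; rewrite !inE; apply/asboolP/orP.
    case: w => s; case/lastP: s => [//|u x] ux /= fu.
    have su : size u == n by rewrite -eqSS -(size_rcons u x).
    have : Tuple ux \in f x @: B x.
      apply/imsetP; exists (Tuple su); last exact: val_inj.
      by rewrite inE; apply/asboolP.
    by case: x ux {fu}; [left | right].
  by case=> /imsetP[u]; rewrite inE => /asboolP fu ->.
have -> : [set w : n.-tuple letter | `[< factor z w >]] = B La :|: B Lb.
  apply/setP => w; rewrite !inE; apply/asboolP/orP.
    by move=> /factor_extend[] ?; [left | right]; apply/asboolP.
  by case=> /asboolP/factor_rconsW.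
have -> : special n = B La :&: B Lb by apply/setP => w; rewrite !inE.
rewrite cardsUI cardsU !card_imset // (_ : _ :&: _ = set0) ?cards0 ?subn0 //.
apply/setP => w; rewrite !inE; apply/negP => /andP[/imsetP[u _ ->] /imsetP[v _]].
by move=> /(congr1 val) /rcons_inj[].
Qed.

End Complexity.

(** * Summing the differences *)

Lemma sum_minn_expnS q n : 0 < q ->
  \sum_(0 <= i < n.+2) minn (q ^ i) (n.+1 - i + 1) =
  \sum_(0 <= i < n.+1) minn (q ^ i) (n - i + 1) + \sum_(j < n.+1) (n - j < q ^ j.+1).
Proof.
move=> q_gt0.
(* Shift to i = j+1; the added term i = 0 vanishes because n+1 < q^0 fails. *)
have -> : \sum_(j < n.+1) (n - j < q ^ j.+1) = \sum_(0 <= i < n.+2) (n.+1 - i < q ^ i).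
  by rewrite big_nat_recl // big_mkord.
(* The terms i = n+1 are both 1. For i <= n, raising the second argument of the minimum by one
   raises the minimum exactly when n-i+1 < q^i. *)
rewrite big_nat_recr //= [X in _ = _ + X]big_nat_recr //= addnA -big_split /= subnn.
rewrite expn_gt0 q_gt0 (minn_idPr _) ?expn_gt0 ?q_gt0 //; congr (_ + _).
apply: eq_big_nat => i /andP[_]; rewrite ltnS => i_le_n.
rewrite subSn // !addn1; case: (ltnP _ (q ^ i)) => [lt|le].
  by rewrite (minn_idPr lt) addn1.
by rewrite (minn_idPl (leqW le)) addn0.
Qed.

Theorem theorem17 (q : nat) (hq : 2 <= q) (z : infinite_word)
    (hz : word_limit (fun k => iter k (h q) [:: La]) z) (n : nat) :
  subword_complexity z n = \sum_(0 <= i < n.+1) minn (q ^ i) (n - i + 1).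
Proof.
elim: n => [|n IH]; last first.
  by rewrite subword_complexityS IH (card_special hq hz) sum_minn_expnS // ltnW.
rewrite big_nat1 expn0 /subword_complexity (_ : [set _ | _] = setT).
  by rewrite cardsT card_tuple.
apply/setP => w; rewrite !inE; apply/asboolP.
by exists 0; rewrite tuple0.
Qed.
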